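(* For every integer $d \geq 1$, let $i(d)$ denote the maximum number of edges of an invertibility critical hypergraph of degree $d$. Then $$3 \cdot 2^{d-2} - 2 \leq i(d) \leq (d-1)\binom{2d-1}{d} + 1.$$
   Context: A hypergraph $\mathbf{H} = (\mathcal{H}, V)$ consists of a finite vertex set $V$ and a family $\mathcal{H}$ of subsets of $V$ (the edges). $\mathbf{H}$ is invertible iff there exists a permutation $\pi$ of $V$ such that $\pi(E) \cap E = \emptyset$ for all $E \in \mathcal{H}$, where $\pi(E) = \{\pi(x) \mid x \in E\}$. $\mathbf{H}$ is invertibility critical iff $\mathbf{H}$ is not invertible but for every $E \in \mathcal{H}$ the hypergraph $(\mathcal{H} \setminus \{E\}, V)$ is invertible. For $x \in V$, the degree of $x$ is $|\{E \in \mathcal{H} \mid x \in E\}|$; $\mathbf{H}$ is of degree $d$ if every vertex has degree at most $d$. *)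

(* Defs.v *)
From HB Require Import structures.
From mathcomp Require Import all_boot all_order all_algebra all_fingroup.

Set Implicit Arguments.
Unset Strict Implicit.
Unset Printing Implicit Defensive.

(* A hypergraph is a finite vertex type V with a set of edges H : {set {set V}};
   the empty set is allowed as an edge and V may be empty. *)

Definition invertible (V : finType) (H : {set {set V}}) : bool :=
  [exists pi : {perm V}, [forall E in H, (pi @: E) :&: E == set0]].

Definition invertibility_critical (V : finType) (H : {set {set V}}) : bool :=
  ~~ invertible H && [forall E in H, invertible (H :\ E)].

Definition degree (V : finType) (H : {set {set V}}) (x : V) : nat :=
  #|[set E in H | x \in E]|.

(* Upper bound only: some vertex of degree exactly d is not required. *)
Definition of_degree (V : finType) (H : {set {set V}}) (d : nat) : bool :=
  [forall x : V, degree H x <= d].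

(* "i(d) = m", the maximum ranging over all finite vertex sets; that the
   maximum is attained is part of the predicate. *)
Definition max_critical_edges (d m : nat) : Prop :=
  (exists (V : finType) (H : {set {set V}}),
     [/\ invertibility_critical H, of_degree H d & #|H| = m]) /\
  (forall (V : finType) (H : {set {set V}}),
     invertibility_critical H -> of_degree H d -> #|H| <= m).

(* Main.v *)
(* By Hall's theorem, H is non-invertible iff there are vertex sets X, Y with
   |X| + |Y| > |V| such that every x in X and y in Y share an edge.

   Upper bound: if H is critical, each edge E is the only common edge of some
   x_E in X and y_E in Y. With A_E, B_E the sets of edges through x_E, y_E, all
   A_E meet all B_F and A_E, B_E meet exactly in E. Choose edges greedily so that
   each new E is not yet covered by the union U of the chosen B's, while B_E
   meets U. Skew Bollobas bounds the number of choices and each of them adds at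
   most d - 1 elements to U. If no further choice is possible but U is not
   everything, every A_E meets both U and its complement, so A_E restricted to
   either part is smaller, and the two parts together satisfy the same bound by
   induction.

   Lower bound: an intersecting family of sets of size at most d gives a
   non-invertible hypergraph, with the members of the family and one fewer
   isolated vertices as V and with one edge for each point (all the members
   through it); the edge is essential if the point is the intersection of two
   members. A doubling construction provides families with many such points. *)

Require Import Defs.
From mathcomp Require Import all_boot all_order all_algebra all_fingroup.
From mathcomp Require Import zify.
From Stdlib Require Import Classical.
Import Order.TTheory GRing.Theory Num.Theory.

Set Implicit Arguments.
Unset Strict Implicit.
Unset Printing Implicit Defensive.

(** * Hall's marriage theorem and the criterion for non-invertibility *)

(** Induction on [#|X|]. If a nonempty proper [Y] has at most [#|Y|] neighbours, [Y] and [X :\: Y]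
    are matched separately, the latter outside the neighbours of [Y]. Otherwise every such set has a
    neighbour to spare, and [x0] may take any of its own. *)
Lemma hall_matching (T : finType) (r : rel T) (X : {set T}) :
  (forall Y : {set T}, Y \subset X ->
     #|Y| <= #|[set y | [exists x in Y, r x y]]|) ->
  exists f : T -> T, {in X &, injective f} /\ {in X, forall x, r x (f x)}.
Proof.
pose nb (r : rel T) (Y : {set T}) := [set y | [exists x in Y, r x y]].
have [n leXn] := ubnP #|X|; elim: n => // n IHn in r X leXn * => hallX.
have [X0|[x0 x0X]] := set_0Vmem X.
  by exists id; split=> x; rewrite X0 inE.
pose tight (Y : {set T}) := [&& Y != set0, Y \proper X & #|nb r Y| <= #|Y|].
case: (pickP tight) => [Y /and3P[Y0 YX leY]|notight].
  have sYX := proper_sub YX.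
  have [||f1 [inj1 rf1]] := IHn r Y.
  - exact: (leq_trans (proper_card YX) leXn).
  - by move=> Z sZY; apply: hallX; apply: subset_trans sYX.
  pose r' x y := r x y && (y \notin nb r Y).
  have [||f2 [inj2 rf2]] := IHn r' (X :\: Y).
  - rewrite -ltnS; apply: leq_trans leXn; rewrite ltnS cardsD (setIidPr sYX).
    rewrite ltn_subrL card_gt0 Y0 (leq_trans _ (subset_leq_card sYX)) //.
    by rewrite card_gt0.
  - move=> Z /subsetDP[sZX dZY].
    (* Hall's condition for [Z :|: Y], less the at most [#|Y|] neighbours of the tight [Y], gives
       the condition for [Z] under [r']. *)
    have := hallX (Z :|: Y); rewrite subUset sZX sYX => /(_ isT).
    rewrite cardsU (disjoint_setI0 dZY) cards0 subn0 => leZY.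
    suff sub : nb r (Z :|: Y) \subset nb r' Z :|: nb r Y.
      rewrite -(leq_add2r #|Y|); apply: leq_trans leZY _.
      apply: leq_trans (subset_leq_card sub) _.
      by apply: leq_trans (leq_card_setU _ _) _; rewrite leq_add2l.
    apply/subsetP=> y; rewrite in_setU.
    case yY: (y \in nb r Y); first by rewrite orbT.
    rewrite orbF !inE => /existsP[x /andP[]].
    rewrite in_setU => /orP[xZ|xY] rxy; last first.
      by move/negP: yY; case; rewrite inE; apply/existsP; exists x; rewrite xY.
    by apply/existsP; exists x; rewrite xZ /r' rxy yY.
  have nbf1 x : x \in Y -> f1 x \in nb r Y.
    by move=> xY; rewrite inE; apply/existsP; exists x; rewrite xY rf1.
  have nbf2 x : x \in X -> x \notin Y -> f2 x \notin nb r Y.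
    by move=> xX xY; have /rf2/andP[] : x \in X :\: Y by rewrite inE xX xY.
  exists (fun x => if x \in Y then f1 x else f2 x); split=> [x y xX yX|x xX].
    case: ifPn => xY; case: ifPn => yY fxy.
    - exact: inj1.
    - by move: (nbf1 _ xY); rewrite fxy (negPf (nbf2 _ yX yY)).
    - by move: (nbf1 _ yY); rewrite -fxy (negPf (nbf2 _ xX xY)).
    - by apply: inj2 => //; rewrite inE ?xX ?xY ?yX ?yY.
  case: ifPn => xY; first exact: rf1.
  by have /rf2/andP[] : x \in X :\: Y by rewrite inE xX xY.
have [y0 rxy0] : exists y, r x0 y.
  have := hallX [set x0]; rewrite sub1set x0X cards1 => /(_ isT)/card_gt0P[y].
  by rewrite inE => /existsP[x /andP[/set1P->]]; exists y.
pose r' x y := r x y && (y != y0).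
have [||f [injf rf]] := IHn r' (X :\ x0).
- by rewrite (cardsD1 x0 X) x0X in leXn.
- move=> Z sZX; have [->|Z0] := eqVneq Z set0; first by rewrite cards0.
  have := notight Z; rewrite /tight Z0 (sub_proper_trans sZX) ?properD1 //=.
  move/negbT; rewrite -ltnNge => ltZ.
  suff sub : nb r Z \subset y0 |: nb r' Z.
    rewrite -ltnS; apply: leq_trans ltZ _.
    apply: leq_trans (subset_leq_card sub) _.
    by rewrite cardsU1; case: (_ \notin _); rewrite // leqW.
  apply/subsetP=> y; rewrite !inE; case: eqVneq => //= yy0.
  move=> /existsP[x /andP[xZ rxy]].
  by apply/existsP; exists x; rewrite xZ /r' rxy yy0.
exists (fun x => if x == x0 then y0 else f x); split=> [x y xX yX|x xX].
  have rfX z : z \in X -> z != x0 -> f z != y0.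
    by move=> zX zx0; have /rf/andP[] : z \in X :\ x0 by rewrite !inE zx0.
  case: eqVneq => [->|xx0]; case: eqVneq => [->|yx0] //.
  - by move=> fy; move: (rfX _ yX yx0); rewrite -fy eqxx.
  - by move=> fx; move: (rfX _ xX xx0); rewrite fx eqxx.
  - by apply: injf; rewrite !inE ?xx0 ?yx0.
case: eqVneq => [->|xx0] //.
by have /rf/andP[] : x \in X :\ x0 by rewrite !inE xx0.
Qed.

Definition covered (V : finType) (H : {set {set V}}) (x y : V) : bool :=
  [exists E in H, (x \in E) && (y \in E)].

(** An inverting permutation is a perfect matching in the relation of sharing no edge. If Hall's
    condition fails at [X], the complement of its neighbourhood serves as [Y]; conversely, [pi @: X]
    and [Y] are too large to be disjoint. *)
Lemma noninvertibleP (V : finType) (H : {set {set V}}) :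
  reflect (exists X Y : {set V}, #|V| < #|X| + #|Y| /\
             {in X & Y, forall x y, covered H x y})
          (~~ invertible H).
Proof.
apply: (iffP idP) => [ninv|[X [Y [ltXY covXY]]]]; last first.
  apply/existsP=> -[pi /forallP piH].
  have : pi @: X :&: Y != set0.
    apply: contraTneq ltXY => XY0; rewrite -leqNgt.
    rewrite -(card_imset (mem X) (@perm_inj _ pi)) -cardsUI XY0 cards0 addn0.
    exact: max_card.
  case/set0Pn=> _ /setIP[/imsetP[x xX ->] yY].
  have /existsP[E /and3P[EH xE pxE]] := covXY _ _ xX yY.
  have := piH E; rewrite EH => /eqP/setP/(_ (pi x)).
  by rewrite !inE pxE imset_f.
pose r x y := ~~ covered H x y.
pose nb (Y : {set V}) := [set y | [exists x in Y, r x y]].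
case: (pickP (fun X : {set V} => #|nb X| < #|X|)) => [X ltX|hallV].
  exists X, (~: nb X); split.
    by rewrite -(cardsC (nb X)) ltn_add2r.
  move=> x y xX; rewrite !inE; apply: contraR => nxy.
  by apply/existsP; exists x; rewrite xX.
case/negP: ninv; have [Y _|f [injf rf]] := @hall_matching _ r setT.
  by rewrite leqNgt hallV.
have {}injf : injective f by move=> x y /injf; apply; rewrite inE.
apply/existsP; exists (perm injf); apply/forallP=> E; apply/implyP=> EH.
apply/eqP/setP=> y; rewrite !inE; apply/negbTE/andP=> -[/imsetP[x xE ->]].
rewrite permE => fxE; have /negP[] := rf x (in_setT x).
by apply/existsP; exists E; rewrite EH xE.
Qed.

(** * The skew Bollobas inequality by a rank argument *)

(* The entry at (i, j) is a form of degree q in the p + 1 coefficients of P_i, so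
   the rank is at most the number of monomials; these are the sorted tuples. *)
Lemma rank_prod_horner (F : fieldType) (p q t : nat) (P : 'I_t -> {poly F})
    (c : 'I_t -> 'I_q -> F) :
  (forall i, size (P i) <= p.+1) ->
  \rank (\matrix_(i < t, j < t) \prod_(s < q) (P i).[c j s])%R
    <= 'C(q + p, q).
Proof.
move=> sizeP.
pose sorted_tuples :=
  [set u : q.-tuple 'I_p.+1 | sorted leq [seq val k | k <- u]].
pose le_val (k l : 'I_p.+1) := val k <= val l.
pose ty (g : {ffun 'I_q -> 'I_p.+1}) : q.-tuple 'I_p.+1 :=
  [tuple of sort le_val [tuple g s | s < q]].
pose N : 'M[F]_(t, #|sorted_tuples|) :=
  (\matrix_(i < t, u < #|sorted_tuples|)
     \prod_(k <- (enum_val u : q.-tuple 'I_p.+1)) (P i)`_(val k))%R.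
pose K : 'M[F]_(#|sorted_tuples|, t) :=
  (\matrix_(u < #|sorted_tuples|, j < t)
     \sum_(g | ty g == enum_val u) \prod_(s < q) c j s ^+ g s)%R.
rewrite -card_sorted_tuples -/sorted_tuples.
suff -> : (\matrix_(i < t, j < t) \prod_(s < q) (P i).[c j s])%R = (N *m K)%R.
  by apply: leq_trans (mxrankM_maxl _ _) _; exact: rank_leq_col.
apply/matrixP=> i j; rewrite !mxE.
under eq_bigr do rewrite (horner_coef_wide _ (sizeP i)).
(* [g] picks one degree per factor; the product of coefficients depends only on the multiset of
   these degrees, hence the grouping by [ty g]. *)
rewrite bigA_distr_bigA /=.
rewrite (partition_big ty (fun u => u \in sorted_tuples)) /=; last first.
  move=> g _; rewrite inE /ty /= sorted_map.
  by apply: sort_sorted => k l; exact: leq_total.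
rewrite big_enum_val; apply: eq_bigr => u _.
rewrite !mxE mulr_sumr; apply: eq_bigr => g /eqP <-.
rewrite big_split /=; congr (_ * _)%R.
rewrite (perm_big _ (permEl (perm_sort _ _))) /= big_map.
by rewrite -[LHS]big_enum enumT.
Qed.

(* The matrix of resultants prod_(x in B_j, a in A_i) (x - a) is triangular with
   nonzero diagonal. [fresh] pads each B_j to exactly [q] nodes. *)
Lemma skew_bollobas (T : finType) (p q t : nat) (A B : 'I_t -> {set T}) :
  (forall i, #|A i| <= p) -> (forall i, #|B i| <= q) ->
  (forall i, A i :&: B i = set0) ->
  (forall i j : 'I_t, i < j -> A i :&: B j != set0) ->
  t <= 'C(p + q, q).
Proof.
move=> leA leB AB0 ABj.
pose pt (x : T) : rat := ((enum_rank x)%:R)%R.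
pose fresh : rat := (#|T|%:R)%R.
have pt_inj : injective pt.
  by move=> x y /eqP; rewrite eqr_nat => /eqP/val_inj/enum_rank_inj.
have pt_fresh x : pt x != fresh.
  by rewrite eqr_nat neq_ltn ltn_ord.
pose P i : {poly rat} := (\prod_(x <- enum (A i)) ('X - (pt x)%:P))%R.
pose c j (s : 'I_q) : rat := nth fresh [seq pt x | x <- enum (B j)] s.
have rootP i y : root (P i) y = (y \in [seq pt x | x <- enum (A i)]).
  by rewrite /P -(big_map pt xpredT (fun z => ('X - z%:P)%R)) root_prod_XsubC.
have rootPpt i x : root (P i) (pt x) = (x \in A i).
  by rewrite rootP mem_map // mem_enum.
have sizeP i : size (P i) <= p.+1.
  by rewrite size_prod_XsubC ltnS -cardE.
have := @rank_prod_horner _ p q t P c sizeP; rewrite [q + p]addnC.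
apply: leq_trans; rewrite mxrank_unit // unitmxE unitfE det_trig.
  apply/prodf_neq0 => i _; rewrite mxE; apply/prodf_neq0 => s _.
  rewrite -/(root _ _) /c.
  have [lts|les] := ltnP s (size (enum (B i))); last first.
    rewrite nth_default ?size_map // rootP.
    by apply/mapP=> -[x _ /eqP]; rewrite eq_sym (negPf (pt_fresh x)).
  have x0 : T by case: (enum (B i)) lts.
  rewrite (nth_map x0) // rootPpt; apply/negP=> xA.
  have := AB0 i; move/setP/(_ (nth x0 (enum (B i)) s)).
  by rewrite !inE xA -mem_enum mem_nth.
apply/is_trig_mxP => i j /ABj/set0Pn[x /setIP[xA xB]].
rewrite mxE; apply/eqP/prodf_eq0.
have xe : x \in enum (B j) by rewrite mem_enum.
have ltx : index x (enum (B j)) < q.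
  by apply: leq_trans (leB j); rewrite cardE index_mem.
exists (Ordinal ltx) => //; rewrite -/(root _ _) /c /=.
by rewrite (nth_map x) ?index_mem // nth_index // rootPpt.
Qed.

(** * The upper bound *)

(** Skew Bollobas for [A x :&: D] without [x], against [B x]: deleting [x] makes the two disjoint,
    and [x \notin B y] for later [y] keeps the other intersections nonempty. *)
Lemma size_chain (T : finType) (c b : nat) (D : {set T}) (A B : T -> {set T})
    (s : seq T) :
  {in s, forall x, #|A x :&: D| <= c.+1} ->
  {in s, forall x, #|B x| <= b} ->
  {in s, forall x, B x \subset D} ->
  {in s, forall x, A x :&: B x = [set x]} ->
  {in s &, forall x y, A x :&: B y != set0} ->
  pairwise (fun x y => x \notin B y) s ->
  size s <= 'C(c + b, b).
Proof.
move=> leA leB sBD AB1 AB0 pw.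
pose x_ := tnth (in_tuple s).
have x_in i : x_ i \in s by exact: mem_tnth.
have mem_ABx x : x \in s -> (x \in A x) && (x \in B x).
  by move=> /AB1/setP/(_ x); rewrite !inE eqxx.
apply: (@skew_bollobas T c b (size s) (fun i => (A (x_ i) :&: D) :\ x_ i)
          (fun i => B (x_ i))) => [i|i|i|i j ltij].
- have /andP[xA xB] := mem_ABx _ (x_in i).
  have xD := subsetP (sBD _ (x_in i)) _ xB.
  have := leA _ (x_in i).
  by rewrite (cardsD1 (x_ i)) !inE xA xD.
- exact: leB.
- apply/setP=> z; rewrite !inE; apply/negbTE/negP.
  case/andP=> /and3P[zx zA zD] zB.
  have /setP/(_ z) := AB1 _ (x_in i).
  by rewrite !inE zA zB (negPf zx).
- have /set0Pn[z /setIP[zA zB]] := AB0 _ _ (x_in i) (x_in j).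
  apply/set0Pn; exists z; rewrite !inE zA zB (subsetP (sBD _ (x_in j))) //.
  rewrite !andbT; apply: contraTneq zB => ->.
  rewrite /x_ !(tnth_nth (x_ i)) /=.
  by move/(pairwiseP (x_ i)): pw => /(_ i j); rewrite !inE; apply.
Qed.

(** This absorbs the factor 2 of a split into two parts. By Pascal's rule it follows from
    ['C(a + b - 1, b) < 'C(a + b - 1, b - 1)], whose strictness pays for the second 1. *)
Lemma twice_bin_bound (a b : nat) : 0 < a < b ->
  2 * ((b - 1) * 'C(a + b - 1, b) + 1) <= (b - 1) * 'C(a + b, b) + 1.
Proof.
case: b => [|[|b]]; rewrite ?ltn0 ?andbF // => /andP[a0 ltab].
  by move: ltab; rewrite ltnS leqNgt a0.
have -> : a + b.+2 - 1 = a + b.+1 by rewrite addnS subn1.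
rewrite (addnS a b.+1) binS subn1 [_.-1]/=.
set n := a + b.+1; set x := 'C(n, b.+2); set y := 'C(n, b.+1).
suff ltxy : x < y.
  rewrite mul2n -addnn addnA leq_add2r mulnDr addnAC -addnA leq_add2l.
  by rewrite addn1 -(ltn_pmul2l (ltn0Sn b)) in ltxy *.
have := mul_bin_left n b.+1; rewrite /n addnK -/n -/x -/y => e.
rewrite -(ltn_pmul2l (ltn0Sn b.+1)) e ltn_pmul2r //.
by rewrite bin_gt0 /n leq_addl.
Qed.

(** Only the trace of [A x] on [S] is bounded, and [a] is separate from [b], so that the induction
    can pass to a part of [S] with [a] lowered and [b] kept. *)
Lemma cross_critical_bound (T : finType) (a b : nat) (S : {set T})
    (A B : T -> {set T}) :
  a <= b ->
  {in S, forall x, #|A x :&: S| <= a} ->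
  {in S, forall x, #|B x| <= b} ->
  {in S, forall x, B x \subset S} ->
  {in S, forall x, A x :&: B x = [set x]} ->
  {in S &, forall x y, A x :&: B y != set0} ->
  #|S| <= (b - 1) * 'C(a + b - 1, b) + 1.
Proof.
elim: a S => [|a IHa] S leab leA leB sBS AB1 AB0.
  have [->|[x xS]] := set_0Vmem S; first by rewrite cards0.
  have /setP/(_ x) := AB1 _ xS; rewrite !inE eqxx => /andP[xA _].
  have := leA _ xS; rewrite leqn0 cards_eq0 => /eqP/setP/(_ x).
  by rewrite !inE xA xS.
have -> : a.+1 + b - 1 = a + b by rewrite addSn subn1.
have [->|[x0 x0S]] := set_0Vmem S; first by rewrite cards0.
pose U s := \bigcup_(x <- s) B x.
(* The newest choice comes first. The first [B] has at most [b] elements and each later one adds at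
   most [b - 1], whence the final 1. *)
pose chain s :=
  [/\ x0 \in s, {subset s <= S}, pairwise (fun x y => x \notin B y) s
     & #|U s| <= size s * (b - 1) + 1].
have [s [[x0s sS pws leU] stuck]] : exists s, chain s /\
    {in S :\: U s, forall x, B x :&: U s = set0}.
  have : chain [:: x0].
    split=> //; rewrite ?inE //; first by move=> x; rewrite inE => /eqP->.
    by rewrite /U big_seq1 mul1n subnK ?leB // (leq_trans _ leab).
  have [n] := ubnP #|S :\: U [:: x0]|.
  elim: n [:: x0] => // n IHn s ltn chs.
  case: (pickP [pred x in S :\: U s | B x :&: U s != set0]) => [x|none].
    case/andP=> /setDP[xS xU] BU; apply: (IHn (x :: s)).
      rewrite -ltnS; apply: leq_trans ltn; apply/proper_card/properP.
      rewrite /U big_cons; split; first by apply: setDS; apply: subsetUr.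
      exists x; rewrite !inE xS ?xU //.
      by have /setP/(_ x) := AB1 _ xS; rewrite !inE eqxx => /andP[_ ->].
    have [x0s sS pws leU] := chs; split=> [|y|/=|].
    - by rewrite inE x0s orbT.
    - by rewrite inE => /predU1P[->|/sS].
    - rewrite pws andbT; apply/allP=> y ys; apply: contra xU => xBy.
      by rewrite /U bigcup_seq; apply/bigcupP; exists y.
    - rewrite /U big_cons cardsU -/(U s) /= mulSn.
      rewrite leq_subLR -!addnA addnCA addnA; apply: leq_add => //.
      apply: leq_trans (leB _ xS) _.
      by rewrite -leq_subLR subKn ?(leq_trans _ leab) // card_gt0.
  exists s; split=> // x xSU; have := none x; rewrite /= xSU /=.
  by move/negbFE/eqP.
have sUS : U s \subset S by rewrite /U bigcup_seq; apply/bigcupsP => x /sS/sBS.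
have Bx_U x : x \in s -> B x \subset U s.
  by move=> xs; rewrite /U bigcup_seq; apply: bigcup_sup.
set W := S :\: U s; have [W0|[w wW]] := set_0Vmem W.
  have -> : S = U s by apply/eqP; rewrite eqEsubset sUS -setD_eq0 -/W W0 eqxx.
  apply: leq_trans leU _; rewrite leq_add2r mulnC leq_mul2l; apply/orP; right.
  apply: (@size_chain T a b S A B) => // x.
  - by move=> /sS; apply: leA.
  - by move=> /sS; apply: leB.
  - by move=> /sS; apply: sBS.
  - by move=> /sS; apply: AB1.
  by move=> y /sS xS /sS yS; apply: AB0.
have sBW x : x \in W -> B x \subset W.
  move=> xW; have /setDP[xS _] := xW.
  by rewrite subsetD sBS //= -setI_eq0 (stuck _ xW) eqxx.
(* [A x] meets [B x0] inside [U s] and [B w] inside [W], so each of its two traces has at most [a]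
   elements. *)
have AUW x : x \in S -> 0 < #|A x :&: U s| /\ 0 < #|A x :&: W|.
  move=> xS; split; rewrite card_gt0.
    have /set0Pn[z /setIP[zA zB]] := AB0 _ _ xS x0S.
    by apply/set0Pn; exists z; rewrite inE zA (subsetP (Bx_U _ x0s)).
  have /setDP[wS _] := wW; have /set0Pn[z /setIP[zA zB]] := AB0 _ _ xS wS.
  by apply/set0Pn; exists z; rewrite inE zA (subsetP (sBW _ wW)).
have cardAUW x : x \in S -> #|A x :&: U s| + #|A x :&: W| <= a.+1.
  move=> xS; apply: leq_trans (leA _ xS).
  by rewrite -(cardsID (U s) (A x :&: S)) -setIA (setIidPr sUS) setIDA leqnn.
have a0 : 0 < a.
  have [U0 W0] := AUW _ x0S.
  rewrite -ltnS; apply: leq_trans (cardAUW _ x0S).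
  by rewrite -[2]/(1 + 1) leq_add.
(* The same chain is counted again, now with the smaller traces on [U s]. *)
have leUb : #|U s| <= (b - 1) * 'C(a + b - 1, b) + 1.
  apply: leq_trans leU _; rewrite leq_add2r mulnC leq_mul2l; apply/orP; right.
  have -> : a + b - 1 = a.-1 + b by rewrite -{1}(prednK a0) addSn subn1.
  apply: (@size_chain T a.-1 b (U s) A B) => // x.
  - move=> /sS xS; rewrite prednK //; have [_ W0] := AUW _ xS.
    by rewrite -ltnS; apply: leq_trans (cardAUW _ xS); rewrite -addn1 leq_add2l.
  - by move=> /sS; apply: leB.
  - by move=> /sS; apply: AB1.
  by move=> y /sS xS /sS yS; apply: AB0.
have leWb : #|W| <= (b - 1) * 'C(a + b - 1, b) + 1.
  have sWS : {subset W <= S} by move=> x /setDP[].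
  apply: IHa => [|x /sWS xS|x /sWS|x /sBW|x /sWS|x y /sWS xS /sWS yS] //.
  - exact: ltnW.
  - have [U0 _] := AUW _ xS.
    by rewrite -ltnS; apply: leq_trans (cardAUW _ xS); rewrite -add1n leq_add2r.
  - exact: leB.
  - exact: AB1.
  - exact: AB0.
rewrite -(cardsID (U s) S) (setIidPr sUS) -/W.
apply: leq_trans (twice_bin_bound _); last by rewrite a0.
by rewrite mul2n -addnn leq_add.
Qed.

Lemma critical_card_le (V : finType) (H : {set {set V}}) (d : nat) :
  invertibility_critical H -> of_degree H d ->
  #|H| <= (d - 1) * 'C(2 * d - 1, d) + 1.
Proof.
case/andP=> /noninvertibleP[X [Y [ltXY covXY]]] /forall_inP crit /forallP degH.
pose star x := [set E in H | x \in E].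
pose only E (xy : V * V) :=
  [&& xy.1 \in X, xy.2 \in Y & ~~ covered (H :\ E) xy.1 xy.2].
have onlyP E : E \in H -> exists xy, only E xy.
  move=> EH; apply/existsP; apply: contraTT (crit E EH) => /existsPn nox.
  apply/noninvertibleP; exists X, Y; split=> // x y xX yY.
  by have := nox (x, y); rewrite /only /= xX yY /= negbK.
have [->|[E0 E0H]] := set_0Vmem H; first by rewrite cards0.
have [xy0 _] := onlyP E0 E0H.
have {onlyP} /fin_all_exists[f fP] E : exists xy, E \in H -> only E xy.
  case EH: (E \in H); last by exists xy0.
  by have [xy] := onlyP E EH; exists xy.
rewrite mul2n -addnn.
apply: (@cross_critical_bound _ _ _ _ (fun E => star (f E).1)
                              (fun E => star (f E).2)) => //.
- move=> E _; apply: leq_trans (degH (f E).1).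
  by apply: subset_leq_card; apply: subsetIl.
- by move=> E _; apply: degH.
- by move=> E _; apply/subsetP=> F; rewrite inE => /andP[].
- move=> E EH; have /and3P[xX yY ncov] := fP E EH.
  have /exists_inP[F FH /andP[xF yF]] := covXY _ _ xX yY.
  have uniqE G : G \in star (f E).1 :&: star (f E).2 -> G = E.
    rewrite !inE => /andP[/andP[GH xG] /andP[_ yG]].
    apply: contraNeq ncov => GE; apply/exists_inP; exists G.
      by rewrite !inE GE GH.
    by rewrite xG yG.
  have FE : F \in star (f E).1 :&: star (f E).2 by rewrite !inE FH xF yF.
  apply/setP=> G; rewrite in_set1; apply/idP/eqP => [/uniqE //|->].
  by rewrite -{1}(uniqE F FE).
- move=> E F EH FH; have /and3P[xX _ _] := fP E EH.
  have /and3P[_ yY _] := fP F FH.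
  have /exists_inP[G GH /andP[xG yG]] := covXY _ _ xX yY.
  by apply/set0Pn; exists G; rewrite !inE GH xG yG.
Qed.

(** * Critical hypergraphs from intersecting families *)

Lemma invertible_sub (V : finType) (H K : {set {set V}}) :
  K \subset H -> invertible H -> invertible K.
Proof.
move=> /subsetP sKH /existsP[pi /forall_inP piH]; apply/existsP; exists pi.
by apply/forall_inP=> E /sKH/piH.
Qed.

(** A minimal non-invertible [K] inside [H] is critical. It contains each [E] in [Q], as otherwise
    it would lie in the invertible [H :\ E]. *)
Lemma exists_critical (V : finType) (H Q : {set {set V}}) (d : nat) :
  ~~ invertible H -> of_degree H d -> Q \subset H ->
  {in Q, forall E, invertible (H :\ E)} ->
  exists K : {set {set V}},
    [/\ invertibility_critical K, of_degree K d & #|Q| <= #|K|].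
Proof.
move=> ninv degH sQH essQ.
have [K /minsetP[ninvK minK] sKH] :
    {K | minset (fun K => ~~ invertible K) K & K \subset H}.
  exact: minset_exists.
exists K; split.
- rewrite /invertibility_critical ninvK; apply/forall_inP=> E EK.
  apply: contraT => ninvKE; have := minK _ ninvKE (subsetDl _ _).
  by move/setP/(_ E); rewrite !inE eqxx EK.
- apply/forallP=> x; apply: leq_trans (forallP degH x).
  apply: subset_leq_card; apply/subsetP=> E; rewrite !inE => /andP[EK ->].
  by rewrite (subsetP sKH).
- apply: subset_leq_card; apply/subsetP=> E EQ.
  apply: contraNT ninvK => EK; apply: invertible_sub (essQ _ EQ).
  apply/subsetP=> F FK; rewrite !inE (subsetP sKH) // andbT.
  by apply: contraNneq EK => <-.
Qed.

Lemma intersecting_critical (K P : finType) (F : K -> {set P}) (Q : {set P})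
    (k0 : K) (d : nat) :
  (forall k, #|F k| <= d) ->
  (forall k l, F k :&: F l != set0) ->
  {in Q, forall p, exists k l, F k :&: F l = [set p]} ->
  exists (V : finType) (H : {set {set V}}),
    [/\ invertibility_critical H, of_degree H d & #|Q| <= #|H|].
Proof.
move=> leF FF essQ.
(* With [#|K|.-1] isolated vertices, twice [#|K|] exceeds the number of vertices by exactly one, so
   no smaller witness is possible inside [C]. *)
pose V : finType := (K + 'I_#|K|.-1)%type.
pose edge p : {set V} := [set inl k | k in [set k | p \in F k]].
have in_edge k p : (inl k \in edge p) = (p \in F k).
  by rewrite (mem_imset _ _ (@inl_inj _ _)) inE.
have inr_edge i p : (inr i \in edge p) = false.
  by apply/imsetP=> -[].
pose H := edge @: [set: P].
have K0 : 0 < #|K| by apply/card_gt0P; exists k0.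
have cardV : #|{: V}| = #|K| + #|K|.-1 by rewrite card_sum card_ord.
have ltV : #|{: V}| < #|K| + #|K| by rewrite cardV ltn_add2l ltn_predL.
pose C : {set V} := [set inl k | k in K].
have cardC : #|C| = #|K| by rewrite card_imset //; exact: inl_inj.
have ninvH : ~~ invertible H.
  apply/noninvertibleP; exists C, C; split; first by rewrite cardC.
  move=> _ _ /imsetP[k _ ->] /imsetP[l _ ->].
  have /set0Pn[p /setIP[pk pl]] := FF k l.
  apply/exists_inP; exists (edge p); first exact: imset_f.
  by rewrite !in_edge pk pl.
have degH : of_degree H d.
  apply/forallP=> -[k|i]; last first.
    rewrite /degree (_ : [set E in H | _] = set0) ?cards0 //.
    apply/setP=> E; rewrite !inE; apply/negbTE/andP=> -[/imsetP[p _ ->]].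
    by rewrite inr_edge.
  apply: leq_trans (leF k); apply: leq_trans (leq_imset_card edge _).
  apply: subset_leq_card; apply/subsetP=> _ /setIdP[/imsetP[p _ ->]].
  by rewrite in_edge => pk; apply: imset_f.
have essQP p : p \in Q -> exists k l,
    [/\ p \in F k, p \in F l & forall q, q \in F k -> q \in F l -> q = p].
  move=> /essQ[k [l /setP e]]; exists k, l.
  have := e p; rewrite !inE eqxx => /andP[-> ->]; split=> // q qk ql.
  by have := e q; rewrite !inE qk ql => /esym/eqP.
have edge_inj : {in Q &, injective edge}.
  move=> p q /essQP[k [l [pk pl uniqp]]] _ epq.
  by apply/esym/uniqp; rewrite -in_edge -epq in_edge.
suff [L [critL degL leL]] : exists L : {set {set V}},
    [/\ invertibility_critical L, of_degree L d & #|edge @: Q| <= #|L|].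
  by exists V, L; split=> //; rewrite -(card_in_imset edge_inj).
apply: (@exists_critical V H) => //.
  by apply: imsetS; apply: subsetT.
move=> _ /imsetP[p /essQP[k [l [pk pl uniqp]]] ->].
apply: contraT => /noninvertibleP[X [Y [ltXY covXY]]].
have inC x q : x \in edge q -> x \in C.
  by case: x => [j|i]; rewrite ?inr_edge // => _; apply: imset_f.
have cov_inl x y : covered (H :\ edge p) x y -> x \in C /\ y \in C.
  case/exists_inP=> E /setD1P[_ /imsetP[q _ ->]].
  by move=> /andP[/inC xC /inC yC].
have leCV (Z : {set V}) : #|Z| <= #|{: V}| by exact: max_card.
(* Neither witness alone exceeds [#|V|], so both are nonempty. Hence all their elements are covered
   and lie in [C], and counting forces [X = Y = C]; but [inl k] and [inl l] share only [edge p]. *)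
have [x xX] : exists x, x \in X.
  apply/card_gt0P; rewrite lt0n; apply: contraTneq ltXY => ->.
  by rewrite -leqNgt add0n leCV.
have [y yY] : exists y, y \in Y.
  apply/card_gt0P; rewrite lt0n; apply: contraTneq ltXY => ->.
  by rewrite -leqNgt addn0 leCV.
have sXC : X \subset C.
  by apply/subsetP=> z zX; have /cov_inl[] := covXY _ _ zX yY.
have sYC : Y \subset C.
  by apply/subsetP=> z zY; have /cov_inl[] := covXY _ _ xX zY.
have [leX leY] := (subset_leq_card sXC, subset_leq_card sYC).
have le2 : #|K| + #|K| <= #|X| + #|Y|.
  by move: ltXY; rewrite cardV -addnS prednK.
have eqX : X = C.
  apply/eqP; rewrite eqEcard sXC -(leq_add2r #|Y|) cardC.
  by apply: leq_trans le2; rewrite leq_add2l -cardC.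
have eqY : Y = C.
  apply/eqP; rewrite eqEcard sYC -(leq_add2l #|X|) cardC.
  by apply: leq_trans le2; rewrite leq_add2r -cardC.
have kC j : inl j \in C by apply: imset_f.
have := covXY (inl k) (inl l); rewrite eqX eqY !kC => /(_ isT isT).
case/exists_inP=> E /setD1P[Ep /imsetP[q _ defE]].
rewrite defE !in_edge => /andP[qk ql].
by rewrite defE (uniqp q) // eqxx in Ep.
Qed.

(** * The doubling construction *)

(** Two families are kept apart because doubling pairs their copies differently; they are merged
    into one intersecting family only at the end. *)
Definition cross_pair (r n : nat) : Prop :=
  exists (P K L : finType) (F : K -> {set P}) (G : L -> {set P}),
    [/\ #|P| = n, forall k, #|F k| <= r, forall l, #|G l| <= r,
        forall k l, F k :&: G l != set0
      & forall p, exists k l, F k :&: G l = [set p]].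

(** Take two copies of the points and two new points. Lifts of [F] and [G] in the same copy get
    different new points, so they meet as before; lifts in different copies get the same new point
    and meet only there. *)
Lemma cross_pair_double (r n : nat) :
  0 < n -> cross_pair r n -> cross_pair r.+1 (2 * n + 2).
Proof.
move=> n0; case=> P [K [L [F [G [cardP leF leG FG essP]]]]].
pose P' : finType := ((P + P) + bool)%type.
pose inj (b : bool) (p : P) : P' := inl (if b then inl p else inr p).
pose lift (c : bool) (b : bool) (X : {set P}) : {set P'} :=
  inr c |: [set inj b p | p in X].
have inj_inj b : injective (inj b) by case: b => p q [].
have in_lift_inj c b b' X p : (inj b' p \in lift c b X) = (b' == b) && (p \in X).
  rewrite !inE /=; case: eqVneq => [->|bb']; first by rewrite mem_imset.
  by apply/imsetP=> -[q _]; case: b b' bb' => [] [].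
have in_lift_inr c b X c' : (inr c' \in lift c b X) = (c' == c).
  rewrite in_setU1 (inj_eq (@inr_inj _ _)); case: eqVneq => //= _.
  by apply/imsetP=> -[].
have card_lift c b X : #|lift c b X| <= #|X|.+1.
  by rewrite cardsU1 (leq_trans (leq_add (leq_b1 _) (leq_imset_card _ _))).
have P'P (z : P') : (exists b p, z = inj b p) \/ exists c, z = inr c.
  case: z => [[p|p]|c]; last by right; exists c.
    by left; exists true, p.
  by left; exists false, p.
pose F' (k : K + K) := match k with
  | inl k => lift true true (F k) | inr k => lift false false (F k) end.
pose G' (l : L + L) := match l with
  | inl l => lift false true (G l) | inr l => lift true false (G l) end.
exists P', (K + K)%type, (L + L)%type, F', G'; split.
- by rewrite !card_sum card_bool cardP mul2n addnn.
- by move=> [k|k]; apply: leq_trans (card_lift _ _ _) _; rewrite ltnS.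
- by move=> [l|l]; apply: leq_trans (card_lift _ _ _) _; rewrite ltnS.
- move=> [k|k] [l|l]; have /set0Pn[p /setIP[pk pl]] := FG k l; apply/set0Pn.
  + by exists (inj true p); rewrite inE !in_lift_inj pk pl.
  + by exists (inr true); rewrite inE !in_lift_inr.
  + by exists (inr false); rewrite inE !in_lift_inr.
  + by exists (inj false p); rewrite inE !in_lift_inj pk pl.
have lift1 c c' b X Y p : c != c' -> X :&: Y = [set p] ->
    lift c b X :&: lift c' b Y = [set inj b p].
  move=> cc' XY; apply/setP=> z; rewrite !(in_setI, in_set1).
  have [[b' [q ->]]|[e ->]] := P'P z.
    rewrite !in_lift_inj; have /setP/(_ q) := XY; rewrite in_setI in_set1.
    case: (eqVneq b' b) => [->|b'b] /=; first by rewrite (inj_eq (@inj_inj b)).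
    by move=> _; apply/esym/eqP; move/eqP: b'b; case: b; case: b'.
  rewrite !in_lift_inr; case: (eqVneq e c) => // ->.
  by rewrite (negPf cc').
have lift2 c b b' X Y : b != b' -> lift c b X :&: lift c b' Y = [set inr c].
  move=> bb'; apply/setP=> z; rewrite !(in_setI, in_set1).
  have [[e [q ->]]|[e ->]] := P'P z; last by rewrite !in_lift_inr andbb.
  by rewrite !in_lift_inj; case: e b b' bb' => [] [] [] //=; rewrite ?andbF.
move=> [[p|p]|c].
- have [k [l e]] := essP p; exists (inl k), (inl l).
  exact: lift1 e.
- have [k [l e]] := essP p; exists (inr k), (inr l).
  exact: lift1 e.
- have /card_gt0P[p _] : 0 < #|P| by rewrite cardP.
  have [k [l _]] := essP p.
  by case: c; [exists (inl k), (inr l)|exists (inr k), (inl l)]; apply: lift2.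
Qed.

(** Each doubling step doubles [n + 2], which starts at 3. *)
Lemma cross_pair_exists (r : nat) : cross_pair r.+1 (3 * 2 ^ r - 2).
Proof.
elim: r => [|r IHr].
  exists unit, unit, unit, (fun=> [set tt]), (fun=> [set tt]).
  split=> [|k|l|k l|p]; rewrite ?card_unit ?cards1 ?setIid //.
    by apply/set0Pn; exists tt; rewrite inE.
  by exists tt, tt; case: p.
have r1 : 0 < 2 ^ r by rewrite expn_gt0.
have -> : 3 * 2 ^ r.+1 - 2 = 2 * (3 * 2 ^ r - 2) + 2.
  by rewrite expnS; lia.
apply: cross_pair_double IHr.
by rewrite subn_gt0 (leq_trans _ (leq_pmulr 3 r1)).
Qed.

Lemma critical_many_edges (d : nat) : 1 <= d ->
  exists (V : finType) (H : {set {set V}}),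
    [/\ invertibility_critical H, of_degree H d & 3 * 2 ^ d <= 4 * (#|H| + 2)].
Proof.
case: d => [|[|r]] // _.
  (* For [d = 1] the inequality is trivial, but a critical hypergraph must still be exhibited. *)
  have [|k l|p _|V [H [critH degH leH]]] :=
    @intersecting_critical unit unit (fun=> [set tt]) setT tt 1.
  - by move=> k; rewrite /= cards1.
  - by apply/set0Pn; exists tt; rewrite !inE.
  - by exists tt, tt; rewrite /= setIid; case: p.
  exists V, H; split=> //.
  by rewrite (@leq_trans (4 * 2)) // leq_mul2l leq_addl.
have [P [K [L [F [G [cardP leF leG FG essP]]]]]] := cross_pair_exists r.
pose P' : finType := (P + bool)%type.
(* One new point common to all lifts of [F] and another to all lifts of [G] make the union
   intersecting, at the cost of one in size; the intersections between [F] and [G] do not change. *)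
pose F' (k : K + L) : {set P'} := match k with
  | inl k => inr true |: [set inl p | p in F k]
  | inr l => inr false |: [set inl p | p in G l] end.
have inrN (X : {set P}) (c : bool) :
    ((inr c : P') \in [set inl p | p in X]) = false.
  by apply/imsetP=> -[].
have meet k l p : F k :&: G l = [set p] ->
    F' (inl k) :&: F' (inr l) = [set inl p].
  move=> /setP e; apply/setP=> -[q|c]; rewrite !(in_setI, in_setU1, in_set1) /=.
    rewrite !(mem_imset _ _ (@inl_inj _ _)).
    by have := e q; rewrite in_setI in_set1.
  by rewrite !inrN; case: c.
have [p0 _] : exists p, p \in P.
  apply/card_gt0P; rewrite cardP subn_gt0.
  by rewrite (leq_trans _ (leq_pmulr 3 _)) ?expn_gt0.
have [k0 _] := essP p0.
have [k|||V [H [critH degH leH]]] :=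
  @intersecting_critical (K + L)%type P' F' [set inl p | p in P] (inl k0) r.+2.
- case: k => k; rewrite cardsU1; apply: (@leq_trans (1 + r.+1)) => //;
    apply: leq_add; rewrite ?leq_b1 //; apply: leq_trans (leq_imset_card _ _) _.
    exact: leF.
  exact: leG.
- move=> [k|k] [l|l]; apply/set0Pn.
  + by exists (inr true); rewrite !inE eqxx.
  + have /set0Pn[p /setIP[pk pl]] := FG k l.
    by exists (inl p); rewrite !inE !imset_f.
  + have /set0Pn[p /setIP[pk pl]] := FG l k.
    by exists (inl p); rewrite !inE !imset_f.
  + by exists (inr false); rewrite !inE eqxx.
- move=> _ /imsetP[p _ ->]; have [k [l e]] := essP p.
  by exists (inl k), (inr l); apply: meet.
exists V, H; split=> //; move: leH; rewrite (card_imset _ (@inl_inj _ _)) cardP.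
rewrite leq_subLR addnC => le3.
by rewrite !expnS (mulnA 2 2) mulnCA -[4]/(2 * 2) leq_pmul2l.
Qed.

(** * The maximum and its bounds *)

Lemma bounded_max (Q : nat -> Prop) (n b : nat) :
  Q n -> (forall m, Q m -> m <= b) ->
  exists i, [/\ Q i, n <= i & forall m, Q m -> m <= i].
Proof.
move=> Qn Qb; have [k] := ubnP (b - n).
elim: k n Qn => // k IHk n Qn ltk.
(* Excluded middle, because [Q] is an arbitrary proposition; in the application it quantifies over
   all finite types. *)
have [[m [Qm ltnm]]|nomore] := classic (exists m, Q m /\ n < m).
  have [||i [Qi lei maxi]] := IHk m => //.
    by have := Qb _ Qm; lia.
  by exists i; split=> //; apply: leq_trans lei; apply: ltnW.
exists n; split=> // m Qm; rewrite leqNgt; apply/negP=> ltnm.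
by case: nomore; exists m.
Qed.

(* The lower bound is rational, with integer exponent d - 2, as d = 1 is
   allowed. *)
Theorem theorem1p1 (d : nat) (hd : 1 <= d) :
  exists i : nat,
    [/\ max_critical_edges d i,
        (3%:Q * 2%:Q ^ (d%:Z - 2) - 2%:Q <= i%:Q)%R
      & i <= (d - 1) * 'C(2 * d - 1, d) + 1].
Proof.
have [V0 [H0 [crit0 deg0 le0]]] := critical_many_edges hd.
pose Q m := exists (V : finType) (H : {set {set V}}),
  [/\ invertibility_critical H, of_degree H d & #|H| = m].
have [|m [V [H [critH degH <-]]]|i [Qi lei maxi]] :=
  @bounded_max Q #|H0| ((d - 1) * 'C(2 * d - 1, d) + 1).
- by exists V0, H0.
- exact: critical_card_le.
have [V [H [critH degH cardH]]] := Qi.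
exists i; split.
- by split=> // V' H' crit' deg'; apply: maxi; exists V', H'.
- have le3 : 3 * 2 ^ d <= 4 * (i + 2).
    by apply: leq_trans le0 _; rewrite leq_mul2l leq_add2r lei.
  (* Splitting the exponent clears the denominator 4 and reduces the claim to [le3]. *)
  have -> : (2%:Q ^ (d%:Z - 2) = 2 ^+ d / 4%:R :> rat)%R.
    by rewrite expfzDr // -exprnP.
  rewrite lerBlDr mulrA ler_pdivrMr // -natrX -natrM -natrD -natrM ler_nat.
  by rewrite [leqRHS]mulnC.
- by rewrite -cardH; apply: critical_card_le.
Qed.
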